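(* Let $\alpha=\frac{3-\sqrt5}{2}$ and for each integer $\ell\ge1$ let $\alpha_\ell=\left(1-\left(\frac{\alpha}{1-\alpha}\right)^{2\lceil \ell/2\rceil}\right)^2\alpha$. Let $G=(V,E)$ be a finite graph with a fractional matching $\boldsymbol{x}$, and let the edges arrive in any order fixed in advance. Run the following algorithm (Tree-OCRS): start with $\mathcal{M}=\emptyset$; when $e=(u,v)$ arrives with state $X_e$, draw independently $A_e\sim\mathrm{Ber}\!\left(\frac{\alpha}{(1-\alpha x_u(e))(1-\alpha x_v(e))}\right)$, and add $e$ to $\mathcal{M}$ if $u$ and $v$ are both unmatched in $\mathcal{M}$, $X_e=1$ and $A_e=1$. Then for every $\ell\ge 1$ and every edge $e\in E$ such that the $\ell$-neighborhood $N^\ell(e)$ is cycle-free, $\Pr[e\in\mathcal{M}\mid X_e=1]\ge\alpha_\ell$.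
   Context: A fractional matching of $G$ is $\boldsymbol{x}\in[0,1]^E$ with $\sum_{e\in\partial(w)}x_e\le1$ for each vertex $w$, where $\partial(w)$ is the set of edges at $w$. Each edge is independently active ($X_e=1$) with probability $x_e$. For an edge $e$ and an endpoint $w$ of $e$, $x_w(e)=\sum_{f\in\partial(w),\,f<e}x_f$ is the total value of edges at $w$ arriving before $e$. For $e=(u,v)$, $N^\ell(e)$ is the set of vertices at graph distance at most $\ell$ from $u$ or $v$; it is cycle-free if the subgraph of $G$ induced by $N^\ell(e)$ contains no cycle. *)

(* Defs.v *)
From mathcomp Require Import all_boot all_order all_algebra.
From mathcomp Require Import reals.

Set Implicit Arguments.
Unset Strict Implicit.
Unset Printing Implicit Defensive.

Import Order.TTheory GRing.Theory Num.Theory.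
Local Open Scope ring_scope.

Record sgraph := SGraph {
  vertex :> finType;
  adj : rel vertex;
  adj_sym : symmetric adj;
  adj_irr : irreflexive adj
}.

Definition edge_set (G : sgraph) : {set {set G}} :=
  [set [set p.1; p.2] | p : G * G & adj p.1 p.2].

(* An edge is the two-element set of its endpoints. *)
Definition edge (G : sgraph) : finType := {e : {set G} | e \in edge_set G}.

Section Neighborhoods.
Variable G : sgraph.

(* Graph distance at most l: some walk from u to w has at most l edges. *)
Definition dist_le (l : nat) (u w : G) : bool :=
  [exists n : 'I_l.+1, exists p : n.-tuple G,
     path (@adj G) u p && (last u p == w)].

Definition neighborhood (l : nat) (e : edge G) : {set G} :=
  [set w | [exists u in val e, dist_le l u w]].

Definition induced (S : {set G}) : rel G :=
  [rel u v | [&& u \in S, v \in S & adj u v]].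

(* The length bound is needed: [ucycle] accepts the degenerate cycles of
   length 0, and [:: u; v] for adjacent u and v. *)
Definition cycle_free (r : rel G) : Prop :=
  forall c : seq G, (2 < size c)%N -> ~ ucycle r c.

End Neighborhoods.

Section TreeOCRS.
Variables (R : realType) (G : sgraph).

Definition alpha : R := (3 - Num.sqrt 5) / 2.

(* [uphalf l] is the ceiling of l / 2. *)
Definition alpha_ (l : nat) : R :=
  (1 - (alpha / (1 - alpha)) ^+ (2 * uphalf l)) ^+ 2 * alpha.

Definition fractional_matching (x : edge G -> R) : Prop :=
  (forall e, 0 <= x e <= 1) /\
  (forall w : G, \sum_(e : edge G | w \in val e) x e <= 1).

(* An arrival order lists every edge exactly once. *)
Definition arrival_order (s : seq (edge G)) : Prop :=
  perm_eq s (enum (edge G)).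

Variables (x : edge G -> R) (s : seq (edge G)).

Definition x_before (w : G) (e : edge G) : R :=
  \sum_(f : edge G | (w \in val f) && (index f s < index e s)%N) x f.

(* The product ranges over the two endpoints of e. *)
Definition attenuation (e : edge G) : R :=
  alpha / \prod_(w in val e) (1 - alpha * x_before w e).

Definition unmatched (M : {set edge G}) (w : G) : bool :=
  [forall f in M, w \notin val f].

(* An outcome is the pair of the states X and the attenuation bits A. *)
Definition outcome : finType :=
  ({ffun edge G -> bool} * {ffun edge G -> bool})%type.

Definition ocrs_step (o : outcome) (M : {set edge G}) (e : edge G) :
    {set edge G} :=
  if [&& [forall w in val e, unmatched M w], o.1 e & o.2 e]
  then e |: M else M.

Definition tree_ocrs (o : outcome) : {set edge G} :=
  foldl (ocrs_step o) set0 s.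

Definition ber (p : R) (b : bool) : R := if b then p else 1 - p.

(* The joint law of the independent X_e ~ Ber(x_e) and A_e. *)
Definition outcome_weight (o : outcome) : R :=
  \prod_(e : edge G) (ber (x e) (o.1 e) * ber (attenuation e) (o.2 e)).

Definition Pr (B : pred outcome) : R := \sum_(o | B o) outcome_weight o.

Definition condPr (B C : pred outcome) : R := Pr (predI B C) / Pr C.

End TreeOCRS.

(* Main.v *)
(** Call a vertex free at an edge if it is unmatched when that edge arrives.
    Freeness of [w] at [f] says that no earlier edge [g] at [w] is active,
    accepted by the attenuation bit, and has its other endpoint free at [g].
    Unrolling this rule [n] times, with "free" replaced by "true" at the bottom,
    gives, in any graph, events that alternately contain the true one (n even)
    and are contained in it (n odd).  While the unrolling stays in the cycle-free
    neighborhood, the events attached to different edges at [w] depend on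
    disjoint sets of edges, so the probability p_n(w, f) satisfies
    p_(n+1)(w, f) = \prod_g (1 - x_g a_g p_n(w', g)), of which 1 - alpha x_w(f) is the
    exact fixed point.  The relative error shrinks by alpha / (1 - alpha) per step;
    an odd depth n = 2 ceil(l/2) - 1 at both endpoints of [e] gives the bound. *)

Require Import Defs.
From mathcomp Require Import all_boot all_order all_algebra.
From mathcomp Require Import reals.
From mathcomp Require Import ring lra.

Set Implicit Arguments.
Unset Strict Implicit.
Unset Printing Implicit Defensive.

Import Order.TTheory GRing.Theory Num.Theory.
Local Open Scope ring_scope.

(** * The constant alpha and its quadratic equation *)

Section Alpha.
Variable R : realType.
Local Notation a := (alpha R).

(** The constant is the smaller root of [t^2 - 3t + 1]. This equation keeps the attenuation at most
    1 and makes the contraction rate equal to [1 - a]. *)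
Lemma alpha_sqr : (1 - a) ^+ 2 = a.
Proof.
have h5 : (Num.sqrt 5 : R) ^+ 2 = 5 by rewrite sqr_sqrtr.
rewrite /alpha; move: h5; set r := Num.sqrt 5 => h5; nra.
Qed.

Lemma alpha_gt0 : 0 < a.
Proof.
have h5 : (Num.sqrt 5 : R) ^+ 2 = 5 by rewrite sqr_sqrtr.
have h0 : 0 <= (Num.sqrt 5 : R) by exact: sqrtr_ge0.
rewrite /alpha; move: h5 h0; set r := Num.sqrt 5 => h5 h0; nra.
Qed.

Lemma alpha_lt1 : a < 1.
Proof.
have h5 : (Num.sqrt 5 : R) ^+ 2 = 5 by rewrite sqr_sqrtr.
have h0 : 0 <= (Num.sqrt 5 : R) by exact: sqrtr_ge0.
rewrite /alpha; move: h5 h0; set r := Num.sqrt 5 => h5 h0; nra.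
Qed.

Lemma alpha_ratio : a / (1 - a) = 1 - a.
Proof.
have h := alpha_lt1; rewrite -{1}alpha_sqr expr2 mulfK //.
by rewrite subr_eq0 eq_sym lt_eqF.
Qed.

End Alpha.

(** * Edges, their endpoints, and distance *)

Section Edges.
Variable G : sgraph.
Implicit Types (u v w z : G) (f g : edge G).

(** The default is never reached, since an edge minus one vertex is nonempty. The value is meant for
    an endpoint [w] of [f]. *)
Definition other w f : G := odflt w [pick z in val f :\ w].

Lemma edge_other {w f} : w \in val f ->
  [/\ forall z, (z \in val f) = (z == w) || (z == other w f),
      other w f != w & adj w (other w f)].
Proof.
case/imsetP: (valP f) => -[p q] /=; rewrite inE /= => pq ef wf.
have npq : p != q by apply: contraTneq pq => ->; rewrite adj_irr.
have mf z : (z \in val f) = (z == p) || (z == q).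
  by rewrite -in_set2 -[in RHS]ef.
have of_ y y' : y != y' -> adj y y' ->
    (forall z, (z \in val f) = (z == y) || (z == y')) -> other y f = y'.
  move=> nyy yy my; rewrite /other; case: pickP => [z|/(_ y')].
    by rewrite in_setD1 my => /andP[/negPf ->] /eqP.
  by rewrite in_setD1 my eq_sym nyy eqxx orbT.
move: wf; rewrite mf => /orP[] /eqP ->.
  by rewrite (@of_ p q) // eq_sym.
have mf' z : (z \in val f) = (z == q) || (z == p) by rewrite mf orbC.
have nqp : q != p by rewrite eq_sym.
have qp : adj q p by rewrite adj_sym.
by rewrite (@of_ q p).
Qed.

Lemma other_in {w f} : w \in val f -> other w f \in val f.
Proof. by move=> /edge_other[-> _ _]; rewrite eqxx orbT. Qed.

Lemma other_other {w f} : w \in val f -> other (other w f) f = w.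
Proof.
move=> wf; have [ef nw _] := edge_other wf.
have [_ no _] := edge_other (other_in wf).
have := other_in (other_in wf); rewrite ef => /orP[/eqP //|].
by rewrite (negPf no).
Qed.

Lemma eq_edge_other {w f g} : w \in val f -> w \in val g ->
  other w f = other w g -> f = g.
Proof.
move=> /edge_other[ef _ _] /edge_other[eg _ _] h.
by apply: val_inj; apply/setP => z; rewrite ef eg h.
Qed.

Lemma dist_leP l u w :
  reflect (exists p : seq G, [/\ (size p <= l)%N, path (@adj G) u p & last u p = w])
    (dist_le l u w).
Proof.
apply: (iffP existsP) => [[n /existsP[p /andP[hp /eqP hl]]]|[p [sp hp hl]]].
  by exists p; split; rewrite // size_tuple -ltnS.
exists (Ordinal (sp : size p < l.+1)%N); apply/existsP; exists (in_tuple p).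
by rewrite /= hp hl eqxx.
Qed.

Lemma neighborhood_endpoint d (e : edge G) w :
  w \in val e -> w \in neighborhood d e.
Proof.
move=> we; rewrite inE; apply/existsP; exists w; rewrite we.
by apply/dist_leP; exists [::].
Qed.

Lemma neighborhoodS d (e : edge G) w z :
  w \in neighborhood d e -> adj w z -> z \in neighborhood d.+1 e.
Proof.
rewrite !inE => /existsP[u /andP[ue /dist_leP[p [sp hp <-]]]] wz.
apply/existsP; exists u; rewrite ue; apply/dist_leP; exists (rcons p z).
by rewrite size_rcons ltnS rcons_path last_rcons hp.
Qed.

Lemma neighborhood_sub d l (e : edge G) w :
  (d <= l)%N -> w \in neighborhood d e -> w \in neighborhood l e.
Proof.
move=> dl; rewrite !inE => /existsP[u /andP[ue /dist_leP[p [sp hp <-]]]].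
apply/existsP; exists u; rewrite ue; apply/dist_leP; exists p.
by rewrite (leq_trans sp).
Qed.

End Edges.

(** * Branches of a cycle-free induced subgraph *)

Section Forest.
Variables (G : sgraph) (S : {set G}).
Hypothesis acyclic : cycle_free (induced S).
Implicit Types (u v w z p : G) (f g : edge G).

(** The component of [w] once [p] is deleted: for adjacent [p] and [w] in the forest, the subtree
    hanging from [w] away from [p]. *)
Definition branch p w : {set G} := [set z | connect (induced (S :\ p)) w z].

Lemma branch_refl p w : w \in branch p w.
Proof. by rewrite inE connect0. Qed.

Lemma branchS p w : w \in S :\ p -> branch p w \subset S :\ p.
Proof.
move=> wS; apply/subsetP => z; rewrite inE => /connectP[q hq ->].
elim: q w wS hq => [|y q IH] w wS //= /andP[/and3P[_ yS _] hq].
exact: IH.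
Qed.

Lemma induced_connect_sym p : connect_sym (induced (S :\ p)).
Proof.
apply: sym_connect_sym => y z; rewrite /induced /= adj_sym.
by rewrite andbCA.
Qed.

(** A common vertex would give a simple path from [a] to [b] avoiding [w], and [w] closes it into a
    cycle. *)
Lemma branch_disjoint w a b : w \in S -> a \in S -> b \in S ->
  adj w a -> adj w b -> a != b -> [disjoint branch w a & branch w b].
Proof.
move=> wS aS bS wa wb ab; apply/pred0P => z /=; apply/negP => /andP[].
rewrite !inE => az; rewrite induced_connect_sym => zb.
have aw : a != w by apply: contraTneq wa => ->; rewrite adj_irr.
have /connectP[q0 hq0 e0] := connect_trans az zb.
case/shortenP: hq0 e0 => q hq uq _ eb.
have qS : all (mem (S :\ w)) q.
  elim: (q) (a) hq => //= y r IH c /andP[/and3P[_ -> _] hr].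
  exact: IH hr.
apply: (@acyclic (w :: a :: q)).
  (* The cycle has at least three vertices because [a != b] forces [q] to be nonempty. *)
  by case: (q) eb => [/= h|//]; rewrite h eqxx in ab.
apply/andP; split; last first.
  rewrite /= -/(uniq (a :: q)) uq andbT inE negb_or eq_sym aw /=.
  by apply/negP => /(allP qS); rewrite !inE eqxx.
rewrite [cycle _ _]/= rcons_path -eb; apply/and3P; split.
- by rewrite /induced /= wS aS.
- apply: sub_path hq => y t /and3P[].
  rewrite !inE => /andP[_ yS] /andP[_ tS] yt.
  by rewrite /induced /= yS tS.
by rewrite /induced /= bS wS adj_sym.
Qed.

(** A walk from [z] avoiding [w] never meets [p], as [p] lies in a disjoint branch at [w]. Prefixing
    it with [w] gives a walk avoiding [p]. *)
Lemma branch_sub p w z : p \in S -> w \in S -> z \in S ->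
  adj w p -> adj w z -> z != p -> branch w z \subset branch p w.
Proof.
move=> pS wS zS wp wz zp; apply/subsetP => y zy.
have dis := branch_disjoint wS zS pS wz wp zp.
have pn : p \notin branch w z.
  by apply/negP => h; move/pred0P/(_ p): dis => /=; rewrite h branch_refl.
have nwp : w != p by apply: contraTneq wp => ->; rewrite adj_irr.
rewrite inE; apply: (connect_trans (y := z)).
  by apply: connect1; rewrite /induced /= !inE nwp zp wS zS.
move: zy; rewrite inE => /connectP[q hq ->]; apply/connectP; exists q => //.
have : {in z :: q, forall t, t \in branch w z}.
  move=> t tq; rewrite inE; case/splitPl: tq hq => q1 q2 <-.
  by rewrite cat_path => /andP[h _]; apply/connectP; exists q1.
(* The induction moves the start of the walk, while [K] must remain the branch of the original
   [z]. *)
move: pn; set K := branch w z => pn; move: K pn => K pn.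
elim: q (z) hq => //= t q IH c /andP[/and3P[]].
rewrite !inE => /andP[_ cS] /andP[_ tS] ct hq hin.
have ne y' : y' \in [:: c, t & q] -> y' != p.
  by move=> /hin h; apply: contraNneq pn => <-.
rewrite /induced /= !inE !ne ?inE ?eqxx ?orbT // cS tS ct /=; apply: IH => // y' hy'.
by apply: hin; rewrite inE hy' orbT.
Qed.

(** A simple path from [u] to a common vertex leaves [u] through a neighbor [a != v] and never
    returns, so that vertex lies in two disjoint branches at [u]. *)
Lemma branch_swap_disjoint u v : u \in S -> v \in S -> adj u v ->
  [disjoint branch v u & branch u v].
Proof.
move=> uS vS uv; apply/pred0P => z /=; apply/negP => /andP[zu zv].
have nvu : v != u by apply: contraTneq uv => ->; rewrite adj_irr.
have : z \in S :\ u.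
  by apply: (subsetP (@branchS u v _)) => //; rewrite !inE nvu vS.
rewrite !inE => /andP[nzu _].
move: zu; rewrite inE => /connectP[q0 hq0 e0].
case/shortenP: hq0 e0 => -[|a q] hq uq _ ez; first by rewrite ez eqxx in nzu.
move: hq => /= /andP[/and3P[_]]; rewrite !inE => /andP[av aS] ua hq.
have zq : z \in branch u a.
  rewrite inE; apply/connectP; exists q; last by rewrite ez.
  have un : u \notin a :: q by case/andP: uq.
  have ne y : y \in a :: q -> y != u by move=> h; apply: contraNneq un => <-.
  elim: q (a) hq ne {uq ez un av aS ua} => //= t q IH c /andP[/and3P[]].
  rewrite !inE => /andP[_ cS] /andP[_ tS] ct hq ne.
  rewrite /induced /= !inE !ne ?inE ?eqxx ?orbT // cS tS ct /=; apply: IH => // y hy.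
  by apply: ne; rewrite inE hy orbT.
have /pred0P/(_ z) /= := branch_disjoint uS aS vS ua uv av.
by rewrite zq zv.
Qed.

End Forest.

(** * The product law of the random bits and independence *)

Section Independence.
Variables (R : realType) (G : sgraph) (x : edge G -> R) (s : seq (edge G)).
Implicit Types (o : outcome G) (D : {set edge G}) (B C : pred (outcome G)).
Local Notation wt := (@outcome_weight R G x s).
Local Notation Prb := (@Pr R G x s).

Lemma expectation_prod (phi psi : edge G -> bool -> R) :
  \sum_o wt o * (\prod_f (phi f (o.1 f) * psi f (o.2 f))) =
  \prod_f ((\sum_b ber (x f) b * phi f b) *
           (\sum_b ber (attenuation x s f) b * psi f b)).
Proof.
rewrite big_split /= !bigA_distr_bigA /= big_distrlr /= pair_big /=.
apply: eq_bigr => o _; rewrite /outcome_weight -!big_split /=.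
by apply: eq_bigr => f _; rewrite mulrACA.
Qed.

Lemma sum_outcome_weight : \sum_o wt o = 1.
Proof.
transitivity (\sum_o wt o * \prod_(f : edge G) ((1 : R) * 1)).
  by apply: eq_bigr => o _; rewrite big1 ?mulr1 // => f _; rewrite mulr1.
rewrite (expectation_prod (fun _ _ => 1) (fun _ _ => 1)) big1 // => f _.
by rewrite !big_bool /ber /= !mulr1 !subrKC mulr1.
Qed.

(** A false flag leaves its bit unconstrained, so one formula covers an active edge with or without
    the attenuation bit. *)
Lemma Pr_bits g (bx ba : bool) :
  Prb (fun o => (bx ==> o.1 g) && (ba ==> o.2 g)) =
  (if bx then x g else 1) * (if ba then attenuation x s g else 1).
Proof.
pose chi (c : bool) f b : R := ((f == g) ==> (c ==> b))%:R.
have := expectation_prod (chi bx) (chi ba).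
rewrite [RHS](bigD1 g) //= [X in _ = _ * X]big1; last first.
  move=> f /negPf fg; rewrite !big_bool /ber /chi fg /= !mulr1.
  by rewrite !subrKC mulr1.
rewrite mulr1 => h; transitivity (\sum_o wt o *
    \prod_f (chi bx f (o.1 f) * chi ba f (o.2 f))); last first.
  rewrite h !big_bool /ber /chi !eqxx /=.
  by case: bx {h}; case: ba; rewrite /= !(mulr1, mulr0, addr0, subrKC, mul1r).
rewrite /Pr [LHS]big_mkcond; apply: eq_bigr => o _ /=.
rewrite (bigD1 g) //= big1 => [|f /negPf fg]; last by rewrite /chi fg /= mulr1.
rewrite /chi !eqxx /= mulr1 -natrM mulnb.
by case: ifP; rewrite ?mulr1 ?mulr0.
Qed.

(** Finite form of measurability with respect to the bits of the edges in [D]. *)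
Definition depends_on D B := forall o o' : outcome G,
  (forall f, f \in D -> o.1 f = o'.1 f /\ o.2 f = o'.2 f) -> B o = B o'.

Definition splice D o o' : outcome G :=
  ([ffun f => if f \in D then o.1 f else o'.1 f],
   [ffun f => if f \in D then o.2 f else o'.2 f]).

Lemma spliceK D o o' : splice D (splice D o o') (splice D o' o) = o.
Proof.
case: o => o1 o2; congr pair; apply/ffunP => f; rewrite !ffunE /=;
  by case: ifP => h; rewrite ?h.
Qed.

(* Exchanging the coordinates in [D] of two independent samples preserves
   their joint law. *)
Lemma Pr_indep D B C : depends_on D B -> depends_on (~: D) C ->
  Prb (fun o => B o && C o) = Prb B * Prb C.
Proof.
move=> dB dC; rewrite /Pr [RHS]big_distrlr /= pair_big /=.
pose h (p : outcome G * outcome G) := (splice D p.1 p.2, splice D p.2 p.1).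
have hK : involutive h by move=> -[o o']; rewrite /h /= !spliceK.
(* After the exchange both conditions fall on the first sample, [B] reading it in [D] and [C]
   outside [D]; the second sample then sums to 1. *)
rewrite (reindex_inj (inv_inj hK)) /=.
transitivity (\sum_(p : outcome G * outcome G | B p.1 && C p.1)
    wt p.1 * wt p.2).
  have -> : \sum_(p : outcome G * outcome G | B p.1 && C p.1) wt p.1 * wt p.2 =
      \sum_(o | B o && C o) \sum_o' wt o * wt o'.
    by rewrite pair_big /=; apply: eq_bigl => p; rewrite andbT.
  by apply: eq_bigr => o _; rewrite -big_distrr /= sum_outcome_weight mulr1.
apply: eq_big => [[o o']|[o o'] _] /=.
  congr andb; [apply: dB | apply: dC] => f; rewrite !ffunE ?inE.
    by move=> ->.
  by move=> /negPf ->.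
rewrite /outcome_weight -!big_split /=; apply: eq_bigr => f _.
by rewrite !ffunE; case: ifP => _ //; rewrite mulrC.
Qed.

Lemma depends_onS D D' B : D \subset D' -> depends_on D B -> depends_on D' B.
Proof. by move=> /subsetP DD' dB o o' h; apply: dB => f /DD'/h. Qed.

Lemma depends_onN D B : depends_on D B -> depends_on D (fun o => ~~ B o).
Proof. by move=> dB o o' /dB ->. Qed.

Lemma depends_onI D B C : depends_on D B -> depends_on D C ->
  depends_on D (fun o => B o && C o).
Proof. by move=> dB dC o o' h; rewrite (dB _ _ h) (dC _ _ h). Qed.

Lemma depends_on_active g : depends_on [set g] (fun o => o.1 g && o.2 g).
Proof. by move=> o o' /(_ g); rewrite set11 => /(_ isT)[-> ->]. Qed.

Lemma Pr_indep_disjoint D D' B C : depends_on D B -> depends_on D' C ->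
  [disjoint D & D'] -> Prb (fun o => B o && C o) = Prb B * Prb C.
Proof.
move=> dB dC dis; apply: (@Pr_indep D) => //.
by apply: depends_onS dC; rewrite -disjoints_subset disjoint_sym.
Qed.

Lemma Pr_true : Prb (fun=> true) = 1.
Proof. exact: sum_outcome_weight. Qed.

Lemma Pr_not B : Prb (fun o => ~~ B o) = 1 - Prb B.
Proof.
by apply/eqP; rewrite eq_sym subr_eq addrC -sum_outcome_weight [eqbLHS](bigID B).
Qed.

Lemma Pr_eq B C : B =1 C -> Prb B = Prb C.
Proof. exact: eq_bigl. Qed.

Lemma depends_on_all (T : eqType) (r : seq T) D (C : T -> pred (outcome G)) :
  (forall g, g \in r -> depends_on D (C g)) ->
  depends_on D (fun o => all (fun g => C g o) r).
Proof.
by move=> dC o o' h; apply: eq_in_all => g gr; apply: (dC g gr).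
Qed.

(** The head reads only [D g], and all remaining events read its complement, so the factors split
    off one by one. *)
Lemma Pr_all_indep (T : eqType) (r : seq T) (D : T -> {set edge G})
    (C : T -> pred (outcome G)) : uniq r ->
  (forall g, g \in r -> depends_on (D g) (C g)) ->
  (forall g h, g \in r -> h \in r -> g != h -> [disjoint D g & D h]) ->
  Prb (fun o => all (fun g => C g o) r) = \prod_(g <- r) Prb (C g).
Proof.
elim: r => [|g r IH] /=; first by rewrite big_nil Pr_true.
move=> /andP[gr ur] dC dis; rewrite big_cons -IH //; first 1 last.
- by move=> h hr; apply: dC; rewrite inE hr orbT.
- by move=> h k hr kr; apply: dis; rewrite inE ?hr ?kr orbT.
apply: (@Pr_indep (D g)); first by apply: dC; rewrite mem_head.
apply: depends_on_all => h hr.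
apply: depends_onS (dC h _); last by rewrite inE hr orbT.
rewrite -disjoints_subset; apply: dis; rewrite ?inE ?hr ?eqxx ?orbT //.
by apply: contraNneq gr => <-.
Qed.

End Independence.

Arguments depends_onS {G D D' B}.
Arguments depends_onN {G D B}.
Arguments depends_onI {G D B C}.
Arguments depends_on_active {G}.

(** * The greedy run and its truncated unrolling *)

Section Greedy.
Variables (G : sgraph) (s : seq (edge G)).
Hypothesis hs : arrival_order s.
Implicit Types (o : outcome G) (w : G) (f g : edge G).

Lemma arrival_order_uniq : uniq s.
Proof. by rewrite (perm_uniq hs) enum_uniq. Qed.

Lemma arrival_order_mem g : g \in s.
Proof. by rewrite (perm_mem hs) mem_enum. Qed.

Lemma mem_edges_before w i g :
  (g \in [seq h : edge G <- take i s | w \in val h]) =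
    (w \in val g) && (index g s < i)%N.
Proof. by rewrite mem_filter in_take ?arrival_order_mem. Qed.

Definition matching_before o i : {set edge G} := foldl (ocrs_step o) set0 (take i s).

(** An edge can enter only at its own arrival, as the order has no repetition; its fate is fixed by
    the matching at that moment. *)
Lemma mem_matching_before o i g :
  (g \in matching_before o i) = (index g s < i)%N &&
    [&& [forall w in val g, unmatched (matching_before o (index g s)) w],
        o.1 g & o.2 g].
Proof.
elim: i => [|i IH]; first by rewrite /matching_before take0 inE.
have gs := arrival_order_mem g.
have [ltis|leis] := ltnP i (size s); last first.
  have gi : (index g s < i)%N by rewrite (leq_trans _ leis) // index_mem.
  have -> : matching_before o i.+1 = matching_before o i.
    by rewrite /matching_before [take i s]take_oversize // take_oversize // leqW.
  rewrite IH.
  by rewrite gi ltnS (ltnW gi).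
rewrite {1}/matching_before (take_nth g) // foldl_rcons -/(matching_before o i).
(* Either the arriving edge is [g] itself, and the step decides, or the step cannot affect [g]. *)
have [gi|gi] := eqVneq (index g s) i.
  rewrite -gi nth_index // ltnSn /= /ocrs_step.
  rewrite -gi in IH; case: ifP => _; first by rewrite setU11.
  by rewrite IH ltnn.
have gn : g != nth g s i.
  by apply: contraNneq gi => {1}->; rewrite index_uniq // arrival_order_uniq.
rewrite ltnS leq_eqVlt (negPf gi) /= -IH /ocrs_step; case: ifP => _ //.
by rewrite in_setU1 (negPf gn).
Qed.

Lemma matching_beforeS o i j : (i <= j)%N ->
  matching_before o i \subset matching_before o j.
Proof.
move=> ij; apply/subsetP => g; rewrite (mem_matching_before o i) => /andP[gi h].
by rewrite (mem_matching_before o j) (leq_trans gi ij) h.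
Qed.

(* Depth-[n] approximation of "[w] is unmatched when [f] arrives", reading the
   greedy rule along non-backtracking walks from [w].  It errs on the safe side
   exactly when [n] is odd. *)
Fixpoint free_approx n w f o : bool :=
  if n is n'.+1 then
    all (fun g : edge G => ~~ ((o.1 g && o.2 g) && free_approx n' (other w g) g o))
        [seq g : edge G <- take (index f s) s | w \in val g]
  else true.

Lemma unmatchedP o w i :
  reflect (forall g, w \in val g -> (index g s < i)%N -> g \notin matching_before o i)
    (unmatched (matching_before o i) w).
Proof.
apply: (iffP forallP) => [h g wg gi|h g]; first by apply: contraTN wg; apply/implyP.
apply/implyP => gM; apply: contraL (gM) => wg; apply: h => //.
by move: gM; rewrite mem_matching_before => /andP[].
Qed.

(** Each level negates the one below, so the direction of the implication flips with the parity of
    [n]. *)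
Lemma free_approx_correct n o w f : w \in val f ->
  if odd n then free_approx n w f o -> unmatched (matching_before o (index f s)) w
  else unmatched (matching_before o (index f s)) w -> free_approx n w f o.
Proof.
elim: n w f => //= n IH w f wf.
have IHg g (wg : w \in val g) := IH _ _ (other_in wg).
case: (odd n) IHg => /= IHg.
  (* Here [n] is odd. An active, accepted [g] whose far endpoint passes the test would find both
     endpoints free and be matched; [w] was free then, since matchings only grow. *)
  move=> /unmatchedP hw; apply/allP => g; rewrite mem_edges_before => /andP[wg gf].
  apply/negP => /andP[/andP[og1 og2] /(IHg _ wg) hw'].
  have := hw g wg gf; rewrite mem_matching_before gf og1 og2 !andbT => /negP[].
  apply/forallP => z; apply/implyP; have [-> _ _] := edge_other wg.
  case/orP => /eqP -> //; apply/unmatchedP => h wh hg.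
  have := hw h wh (ltn_trans hg gf); apply: contra; apply/subsetP.
  exact/matching_beforeS/ltnW.
(* Here [n] is even. A matched [g] had a free far endpoint, which passes the test and contradicts
   the hypothesis on [g]. *)
move=> /allP hw; apply/unmatchedP => g wg gf; apply/negP.
rewrite mem_matching_before gf /= => /and3P[/forallP hg og1 og2].
have := hw g; rewrite mem_edges_before wg gf og1 og2 => /(_ isT)/negP[].
by apply: (IHg _ wg); apply: (implyP (hg _)); exact: other_in.
Qed.

Lemma mem_tree_ocrs o (e : edge G) (u : G) : u \in val e -> forall n, odd n ->
  o.1 e -> o.2 e -> free_approx n u e o -> free_approx n (other u e) e o ->
  e \in tree_ocrs s o.
Proof.
move=> ue n odn o1 o2 hu hv.
have -> : tree_ocrs s o = matching_before o (size s).
  by rewrite /matching_before take_size.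
rewrite mem_matching_before index_mem arrival_order_mem o1 o2 !andbT /=.
apply/forallP => z; apply/implyP; have [-> _ _] := edge_other ue.
have := free_approx_correct n o ue.
have := free_approx_correct n o (other_in ue).
by rewrite odn => hv' hu' /orP[] /eqP ->; [exact: hu' | exact: hv'].
Qed.

End Greedy.

(** * Bounds on the rates, and products along the arrivals *)

Section Rates.
Variables (R : realType) (G : sgraph) (x : edge G -> R) (s : seq (edge G)).
Hypotheses (hx : fractional_matching x) (hs : arrival_order s).
Implicit Types (w : G) (f g : edge G).
Local Notation a := (alpha R).

Lemma x_ge0 g : 0 <= x g.
Proof. by case: hx => /(_ g)/andP[]. Qed.

Lemma x_le1 g : x g <= 1.
Proof. by case: hx => /(_ g)/andP[]. Qed.

Lemma x_beforeE w g :
  x_before x s w g =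
    \sum_(h <- take (index g s) s | w \in val (h : edge G)) x h.
Proof.
rewrite -[RHS]big_filter big_uniq ?filter_uniq ?take_uniq ?(arrival_order_uniq hs) //.
by apply: eq_bigl => h; rewrite mem_edges_before.
Qed.

Lemma x_before_ge0 w g : 0 <= x_before x s w g.
Proof. by apply: sumr_ge0 => f _; exact: x_ge0. Qed.

Lemma x_before_le1 w g : x_before x s w g <= 1.
Proof.
case: (hx) => _ /(_ w); apply: le_trans.
rewrite [leRHS](bigID (fun f => index f s < index g s)%N) /= lerDl.
by apply: sumr_ge0 => f _; exact: x_ge0.
Qed.

Lemma vacancy_ge w g : 1 - a <= 1 - a * x_before x s w g.
Proof.
have := x_before_le1 w g; have := alpha_gt0 R; nra.
Qed.

Lemma vacancy_gt0 w g : 0 < 1 - a * x_before x s w g.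
Proof. by apply: lt_le_trans (vacancy_ge w g); rewrite subr_gt0 alpha_lt1. Qed.

(** Both sides are compared with [a = (1 - a)^2]. This is the source of the contraction by [1 - a]
    per level. *)
Lemma occupancy_le w g :
  a * x_before x s w g <= (1 - a) * (1 - a * x_before x s w g).
Proof.
apply: (@le_trans _ _ a).
  by rewrite -[leRHS]mulr1 ler_pM2l ?alpha_gt0 ?x_before_le1.
rewrite -[leLHS]alpha_sqr expr2 ler_wpM2l ?vacancy_ge //.
by rewrite subr_ge0 ltW ?alpha_lt1.
Qed.

Lemma attenuationE w g : w \in val g -> attenuation x s g =
  a / ((1 - a * x_before x s w g) * (1 - a * x_before x s (other w g) g)).
Proof.
move=> wg; have [eg nw _] := edge_other wg.
rewrite /attenuation (bigD1 w) //= (big_pred1 (other w g)) // => z /=.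
rewrite eg; case: (eqVneq z w) => [->|] /=; last by rewrite andbT.
by rewrite eq_sym (negPf nw).
Qed.

Lemma edge_inhabited g : exists w, w \in val g.
Proof.
case/imsetP: (valP g) => -[p q] /= _ ef; exists p.
suff : p \in [set p; q] by rewrite -ef.
by rewrite set21.
Qed.

Lemma attenuation_ge0 g : 0 <= attenuation x s g.
Proof.
have [w wg] := edge_inhabited g; rewrite (attenuationE wg).
by rewrite divr_ge0 ?ltW ?alpha_gt0 // mulr_gt0 ?vacancy_gt0.
Qed.

(** Each of the two factors of the denominator is at least [1 - a], and [(1 - a)^2 = a]. *)
Lemma attenuation_le1 g : attenuation x s g <= 1.
Proof.
have [w wg] := edge_inhabited g; rewrite (attenuationE wg).
rewrite ler_pdivrMr ?mulr_gt0 ?vacancy_gt0 // mul1r -[leLHS]alpha_sqr expr2.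
by rewrite ler_pM ?vacancy_ge // subr_ge0 ltW ?alpha_lt1.
Qed.

Lemma outcome_weight_ge0 o : 0 <= outcome_weight x s o.
Proof.
apply: prodr_ge0 => f _; rewrite /ber.
by apply: mulr_ge0; case: ifP => _; rewrite ?subr_ge0 ?x_ge0 ?x_le1 ?attenuation_ge0
  ?attenuation_le1.
Qed.

Lemma Pr_ge0 (B : pred (outcome G)) : 0 <= Pr x s B.
Proof. by apply: sumr_ge0 => o _; exact: outcome_weight_ge0. Qed.

Lemma Pr_sub (B C : pred (outcome G)) : (forall o, B o -> C o) -> Pr x s B <= Pr x s C.
Proof.
move=> BC; rewrite /Pr [leLHS]big_mkcond [leRHS]big_mkcond.
apply: ler_sum => o _; case: ifP => [/BC -> //|_].
by case: ifP => // _; exact: outcome_weight_ge0.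
Qed.

Lemma Pr_le1 (B : pred (outcome G)) : Pr x s B <= 1.
Proof. by rewrite -(Pr_true x s); exact: Pr_sub. Qed.

(** Induction over the arrivals at [w], carrying the running sum of [x] and the running product of
    [c] together; just before [g] the sum is [x_before]. *)
Lemma edges_before_ind w (P : R -> R -> Prop) (c : edge G -> R) : P 0 1 ->
  (forall g p, w \in val g -> P (x_before x s w g) p ->
     P (x_before x s w g + x g) (p * c g)) ->
  forall i, P (\sum_(g <- take i s | w \in val (g : edge G)) x g)
              (\prod_(g <- take i s | w \in val (g : edge G)) c g).
Proof.
move=> P0 PS; elim=> [|i IH]; first by rewrite take0 !big_nil.
have [ltis|leis] := ltnP i (size s); last first.
  by move: IH; rewrite !take_oversize // leqW.
have [g0 _] : exists g0 : edge G, true by case: (s) ltis => // g0; exists g0.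
rewrite (take_nth g0) // -cats1 !big_cat /= !big_cons !big_nil.
set g := nth g0 s i; case: ifP => wg; last by rewrite addr0 mulr1.
have gi : index g s = i by rewrite index_uniq // (arrival_order_uniq hs).
by move: IH; rewrite -gi -x_beforeE addr0 mulr1 => /(PS g); apply.
Qed.

(** For [k = 1] with equality the product telescopes: [(1 - a y) (1 - c) = 1 - a (y + x)]. For
    [k >= 1], [1 - k a y <= 1 - a y], so each factor lowers the bound by at most [k a x]. *)
Lemma prod_vacancy_ge w (k : R) (c : edge G -> R) f : 1 <= k ->
  (forall g, w \in val g -> 0 <= c g <= 1 /\
     c g * (1 - a * x_before x s w g) <= k * a * x g) ->
  1 - k * a * x_before x s w f <=
    \prod_(g <- take (index f s) s | w \in val (g : edge G)) (1 - c g).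
Proof.
move=> k1 hc; rewrite x_beforeE.
pose P y p := 0 <= p /\ 1 - k * a * y <= p.
apply: (proj2 (edges_before_ind (P := P) _ _ _)).
  by rewrite /P mulr0 subr0 ler01.
move=> g p wg [p0 yp]; have [/andP[c0 c1] cv] := hc g wg.
have a0 := alpha_gt0 R; have x0 := x_ge0 g; have y0 := x_before_ge0 w g.
move: yp cv y0; set y := x_before x s w g => yp cv y0.
have k0 : 0 <= k := le_trans ler01 k1.
have kax : 0 <= k * a * x g := mulr_ge0 (mulr_ge0 k0 (ltW a0)) x0.
have c1' : 0 <= 1 - c g by rewrite subr_ge0.
split; first by rewrite mulr_ge0.
rewrite mulrDr opprD addrA.
have [L0|L0] := leP (1 - k * a * y) 0.
  by apply: le_trans (mulr_ge0 p0 c1'); rewrite subr_le0 (le_trans L0).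
apply: le_trans (ler_wpM2r c1' yp); rewrite mulrBr mulr1 lerB //.
apply: le_trans cv; rewrite mulrC ler_wpM2l // lerB //.
by rewrite -mulrA ler_peMl // mulr_ge0 // ltW.
Qed.

(** The mirror image: [k <= 1] gives [1 - a y <= 1 - k a y], so each factor lowers the bound by at
    least [k a x]. *)
Lemma prod_vacancy_le w (k : R) (c : edge G -> R) f : k <= 1 ->
  (forall g, w \in val g -> 0 <= c g <= 1 /\
     k * a * x g <= c g * (1 - a * x_before x s w g)) ->
  \prod_(g <- take (index f s) s | w \in val (g : edge G)) (1 - c g) <=
    1 - k * a * x_before x s w f.
Proof.
move=> k1 hc; rewrite x_beforeE.
pose P y p := p <= 1 - k * a * y.
apply: (edges_before_ind (P := P)); first by rewrite /P mulr0 subr0.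
rewrite /P => g p wg yp; have [/andP[c0 c1] cv] := hc g wg.
have a0 := alpha_gt0 R; have y0 := x_before_ge0 w g.
move: yp cv y0; set y := x_before x s w g => yp cv y0.
have c1' : 0 <= 1 - c g by rewrite subr_ge0.
apply: le_trans (ler_wpM2r c1' yp) _.
rewrite (mulrDr (k * a)) opprD addrA mulrBr mulr1 lerB //.
apply: le_trans cv _; rewrite mulrC ler_wpM2r // lerB //.
by rewrite -mulrA ler_piMl // mulr_ge0 // ltW.
Qed.

End Rates.

(** * The recursion for the approximations inside the cycle-free neighborhood *)

Section LocalTree.
Variables (R : realType) (G : sgraph) (x : edge G -> R) (s : seq (edge G)).
Hypotheses (hx : fractional_matching x) (hs : arrival_order s).
Variables (l : nat) (e : edge G).
Local Notation S := (neighborhood l e).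
Hypothesis hcf : cycle_free (induced S).
Implicit Types (w : G) (f g h : edge G).
Local Notation a := (alpha R).

Definition edges_in (K : {set G}) : {set edge G} := [set g : edge G | val g \subset K].

Lemma edges_inP (K : {set G}) g :
  reflect (forall z, z \in val g -> z \in K) (g \in edges_in K).
Proof. by rewrite inE; apply: subsetP. Qed.

Lemma edges_inS (K K' : {set G}) : K \subset K' -> edges_in K \subset edges_in K'.
Proof.
by move=> /subsetP KK'; apply/subsetP => g /edges_inP gK; apply/edges_inP => z /gK/KK'.
Qed.

Lemma edges_in_disjoint (K K' : {set G}) :
  [disjoint K & K'] -> [disjoint edges_in K & edges_in K'].
Proof.
move=> /pred0P dis; apply/pred0P => g /=.
apply/negP => /andP[/edges_inP gK /edges_inP gK'].
have [z zg] := edge_inhabited g; have := dis z.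
by rewrite /= gK // gK'.
Qed.

Lemma branch_notin w z g : w \in val g -> z \in S -> z != w ->
  g \notin edges_in (branch S w z).
Proof.
move=> wg zS zw; apply/negP => /edges_inP/(_ w wg).
have zSw : z \in S :\ w by rewrite in_setD1 zw.
by move/(subsetP (branchS zSw)); rewrite in_setD1 eqxx.
Qed.

(** The edges whose bits decide, in the unrolled rule, whether [g] blocks [w]: [g] and the subtree
    beyond it. *)
Definition block w g : {set edge G} := g |: edges_in (branch S w (other w g)).

(** Branches at distinct neighbors of [w] are disjoint, and [g], [h] contain [w], which neither
    branch does. The bound [d < l] keeps these neighbors in [S]. *)
Lemma block_disjoint d w g h : w \in neighborhood d e -> (d < l)%N ->
  w \in val g -> w \in val h -> g != h -> [disjoint block w g & block w h].
Proof.
move=> wd dl wg wh gh.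
have wS : w \in S := neighborhood_sub (ltnW dl) wd.
have [_ ng ag] := edge_other wg; have [_ nh ah] := edge_other wh.
have gS : other w g \in S := neighborhood_sub dl (neighborhoodS wd ag).
have hS : other w h \in S := neighborhood_sub dl (neighborhoodS wd ah).
have ogh : other w g != other w h.
  by apply: contraNneq gh => /(eq_edge_other wg wh) ->.
have dis := edges_in_disjoint (branch_disjoint hcf wS gS hS ag ah ogh).
apply/pred0P => k /=; apply/negP => /andP[].
rewrite !in_setU1 => /orP[/eqP ->|kg] /orP[/eqP kh|kh].
- by rewrite kh eqxx in gh.
- by move/negP: (branch_notin wg hS nh).
- by rewrite kh in kg; move/negP: (branch_notin wh gS ng).
by have /pred0P/(_ k) /= := dis; rewrite kg kh.
Qed.

Lemma block_sub d w f g : w \in neighborhood d e -> (d < l)%N ->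
  w \in val f -> other w f \in S -> w \in val g -> g != f ->
  block w g \subset edges_in (branch S (other w f) w).
Proof.
move=> wd dl wf fS wg gf.
have wS : w \in S := neighborhood_sub (ltnW dl) wd.
have [mg ng ag] := edge_other wg; have [_ nf af] := edge_other wf.
have gS : other w g \in S := neighborhood_sub dl (neighborhoodS wd ag).
have ogf : other w g != other w f.
  by apply: contraNneq gf => /(eq_edge_other wg wf) ->.
have sub := branch_sub hcf fS wS gS af ag ogf.
rewrite subUset edges_inS // andbT sub1set; apply/edges_inP => z.
rewrite mg => /orP[] /eqP ->; first exact: branch_refl.
by apply: (subsetP sub); exact: branch_refl.
Qed.

(** Each level steps from [w] away from [f] and one further from [e], so [d + n <= l] keeps the
    unrolling inside [S]. *)
Lemma free_approx_depends n d w f : w \in val f ->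
  w \in neighborhood d e -> other w f \in S -> (d + n <= l)%N ->
  depends_on (edges_in (branch S (other w f) w)) (free_approx s n w f).
Proof.
elim: n d w f => [|n IH] d w f wf wd fS dn //=.
have dl : (d < l)%N by rewrite (leq_trans _ dn) // addnS ltnS leq_addr.
have wS : w \in S := neighborhood_sub (ltnW dl) wd.
apply: depends_on_all => g; rewrite mem_edges_before // => /andP[wg gf].
(* Only strictly earlier edges are read, so the unrolling never goes back through [f]. *)
have gnf : g != f by apply: contraTneq gf => ->; rewrite ltnn.
have [_ _ ag] := edge_other wg.
apply: depends_onS (block_sub wd dl wf fS wg gnf) _; apply/depends_onN/depends_onI.
  by apply: depends_onS (depends_on_active g); rewrite sub1set setU11.
apply: depends_onS (subsetUr _ _) _.
have := IH d.+1 (other w g) g (other_in wg) (neighborhoodS wd ag).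
by rewrite (other_other wg) addSnnS; apply.
Qed.

Lemma free_approx_other_depends n d w g : w \in val g ->
  w \in neighborhood d e -> (d + n < l)%N ->
  depends_on (edges_in (branch S w (other w g))) (free_approx s n (other w g) g).
Proof.
move=> wg wd dn; have [_ _ ag] := edge_other wg.
have wS : w \in S.
  by apply: neighborhood_sub wd; rewrite (leq_trans _ (ltnW dn)) ?leq_addr.
have := @free_approx_depends n d.+1 (other w g) g (other_in wg) (neighborhoodS wd ag).
by rewrite (other_other wg); apply.
Qed.

Lemma Pr_active g (K : {set G}) (C : pred (outcome G)) :
  depends_on (edges_in K) C -> g \notin edges_in K ->
  Pr x s (fun o => (o.1 g && o.2 g) && C o) = x g * attenuation x s g * Pr x s C.
Proof.
move=> dC gK; rewrite -(Pr_bits x s g true true).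
apply: Pr_indep_disjoint (depends_on_active g) dC _.
by rewrite disjoints1.
Qed.

(** The conditions for different [g] read disjoint blocks, which gives the product; within a block
    the bits of [g] lie outside the branch beyond it, which splits each factor. *)
Lemma Pr_free_approxS n d w f : w \in neighborhood d e -> (d + n < l)%N ->
  Pr x s (free_approx s n.+1 w f) =
  \prod_(g <- take (index f s) s | w \in val (g : edge G))
    (1 - x g * attenuation x s g * Pr x s (free_approx s n (other w g) g)).
Proof.
move=> wd dn; have dl : (d < l)%N by rewrite (leq_trans _ dn) // ltnS leq_addr.
rewrite /= (@Pr_all_indep _ _ _ _ _ _ (block w)); first 1 last.
- by rewrite filter_uniq // take_uniq // (arrival_order_uniq hs).
- move=> g; rewrite mem_filter => /andP[wg _]; apply/depends_onN/depends_onI.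
    by apply: depends_onS (depends_on_active g); rewrite sub1set setU11.
  apply: depends_onS (subsetUr _ _) _; exact: free_approx_other_depends wd dn.
- move=> g h; rewrite !mem_filter => /andP[wg _] /andP[wh _].
  exact: block_disjoint wd dl wg wh.
rewrite big_filter; apply: eq_bigr => g wg; rewrite Pr_not; congr (1 - _).
apply: Pr_active (free_approx_other_depends wg wd dn) _.
have [_ ng ag] := edge_other wg; apply: branch_notin => //.
exact: neighborhood_sub dl (neighborhoodS wd ag).
Qed.

(* By [occupancy_le] the relative error contracts by
   [alpha / (1 - alpha) = 1 - alpha] per level. *)
Lemma Pr_free_approx_bound n d w f : w \in neighborhood d e -> (d + n <= l)%N ->
  if odd n then
    1 - (1 + (1 - a) ^+ n) * a * x_before x s w f <= Pr x s (free_approx s n w f)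
  else
    Pr x s (free_approx s n w f) <= 1 - (1 - (1 - a) ^+ n) * a * x_before x s w f.
Proof.
elim: n d w f => [|n IH] d w f wd dn /=.
  by rewrite expr0 subrr !mul0r subr0 Pr_true.
rewrite addnS in dn; rewrite (Pr_free_approxS f wd dn).
have a0 := alpha_gt0 R; have a1 := alpha_lt1 R; have a2 := alpha_sqr R.
have r0 : 0 <= (1 - a) ^+ n by rewrite exprn_ge0 // subr_ge0 ltW.
have rS : (1 - a) ^+ n.+1 = (1 - a) * (1 - a) ^+ n by rewrite exprS.
(* The last identity cancels the attenuation's denominator at [w], leaving the ratio of the
   approximate to the exact vacancy at the far endpoint. *)
have common g : w \in val g ->
    [/\ 0 <= x g * attenuation x s g * Pr x s (free_approx s n (other w g) g) <= 1,
       a * x_before x s (other w g) g <= (1 - a) * (1 - a * x_before x s (other w g) g),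
       0 < 1 - a * x_before x s (other w g) g &
       x g * attenuation x s g * Pr x s (free_approx s n (other w g) g) *
         (1 - a * x_before x s w g) = a * x g *
         (Pr x s (free_approx s n (other w g) g) / (1 - a * x_before x s (other w g) g))].
  move=> wg; split.
  - have x0 := x_ge0 hx g; have t0 := attenuation_ge0 s hx g.
    have p0 := Pr_ge0 s hx (free_approx s n (other w g) g).
    have xt0 := mulr_ge0 x0 t0; rewrite mulr_ge0 //=.
    apply: mulr_ile1 => //; last exact: Pr_le1.
    by apply: mulr_ile1 => //; [exact: x_le1 | exact: attenuation_le1].
  - exact: occupancy_le.
  - exact: vacancy_gt0.
  rewrite (attenuationE x s wg).
  have v1 := vacancy_gt0 s hx w g; have v2 := vacancy_gt0 s hx (other w g) g.
  by field; rewrite !lt0r_neq0.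
have IHg g (wg : w \in val g) :=
  IH d.+1 (other w g) g (neighborhoodS wd (let: And3 _ _ h := edge_other wg in h)) dn.
case: (odd n) IHg => /= IHg.
  (* Take [k = 1 - (1 - a)^(n+1)]. With [v = 1 - a y] at the far endpoint, the induction hypothesis
     is [p >= v - (1 - a)^n a y], and [a y <= (1 - a) v] yields [p >= k v]. *)
  apply: (prod_vacancy_le hx hs).
    by rewrite lerBlDr lerDl exprn_ge0 // subr_ge0 ltW.
  move=> g wg; have [c01 yv v0 ->] := common g wg; split => //.
  rewrite -[_ * a * x g]mulrA mulrC (ler_wpM2l (mulr_ge0 (ltW a0) (x_ge0 hx g))) //.
  rewrite ler_pdivlMr //; apply: le_trans (IHg g wg); rewrite rS.
  move: yv v0; set y := x_before _ _ _ _ => yv v0; nra.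
(* Symmetrically, [k = 1 + (1 - a)^(n+1)] and [p <= v + (1 - a)^n a y] yield [p <= k v]. *)
apply: (prod_vacancy_ge hx hs).
  by rewrite lerDl exprn_ge0 // subr_ge0 ltW.
move=> g wg; have [c01 yv v0 ->] := common g wg; split => //.
rewrite -[_ * a * x g]mulrA [leRHS]mulrC (ler_wpM2l (mulr_ge0 (ltW a0) (x_ge0 hx g))) //.
rewrite ler_pdivrMr //; apply: le_trans (IHg g wg) _; rewrite rS.
move: yv v0; set y := x_before _ _ _ _ => yv v0; nra.
Qed.

End LocalTree.

(** * The bound at an edge with cycle-free neighborhood *)

Theorem theorem5 (R : realType) (G : sgraph) (x : edge G -> R)
    (hx : fractional_matching x)
    (s : seq (edge G)) (hs : arrival_order s)
    (l : nat) (hl : (1 <= l)%N)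
    (e : edge G) (hcf : cycle_free (induced (neighborhood l e)))
    (hxe : 0 < x e) :
  alpha_ R l <= condPr x s (fun o => e \in tree_ocrs s o) (fun o => o.1 e).
Proof.
have [u ue] := edge_inhabited e.
pose v := other u e; have ve : v \in val e := other_in ue.
have [_ _ uv] := edge_other ue.
have vu : other v e = u := other_other ue.
(* The largest odd depth not exceeding [l]; odd, so that the approximation is safe, and [n.+1] is
   the exponent in [alpha_]. *)
pose n := (2 * uphalf l).-1.
have m0 : (0 < uphalf l)%N by rewrite uphalf_gt0.
have nS : n.+1 = (2 * uphalf l)%N by rewrite prednK // muln_gt0.
have odn : odd n.
  have : ~~ odd n.+1 by rewrite nS oddM.
  by rewrite /= negbK.
have nl : (n <= l)%N.
  by rewrite -ltnS nS mul2n -[l.+1]odd_double_half uphalfE leq_addl.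
have inS w : w \in val e -> w \in neighborhood l e by exact: neighborhood_endpoint.
have dep w : w \in val e -> depends_on
    (edges_in (branch (neighborhood l e) (other w e) w)) (free_approx s n w e).
  move=> we; apply: (free_approx_depends hs hcf (d := 0)) => //.
    exact: neighborhood_endpoint.
  exact/inS/other_in.
have du := dep u ue; have dv := dep v ve; rewrite vu -/v in du dv.
have dis := edges_in_disjoint (branch_swap_disjoint hcf (inS _ ue) (inS _ ve) uv).
have PX : Pr x s (fun o => o.1 e) = x e.
  have := Pr_bits x s e true false; rewrite mulr1 => <-.
  by apply: Pr_eq => o /=; rewrite andbT.
rewrite /condPr PX ler_pdivlMr //.
(* A sufficient event for [e] to be matched, built from three parts that read disjoint sets of
   edges. *)
pose B (o : outcome G) :=
  (o.1 e && o.2 e) && (free_approx s n u e o && free_approx s n v e o).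
apply: le_trans (Pr_sub s hx (B := B) _); last first.
  move=> o /andP[/andP[o1 o2] /andP[fu fv]]; rewrite /= o1 andbT.
  exact: (mem_tree_ocrs hs ue odn).
(* One more use of [occupancy_le] turns the additive error at depth [n] into the relative error
   [(1 - a)^(n+1)]. *)
have low w : w \in val e ->
    (1 - (1 - alpha R) ^+ n.+1) * (1 - alpha R * x_before x s w e)
    <= Pr x s (free_approx s n w e).
  move=> we.
  have := Pr_free_approx_bound hx hs hcf e (neighborhood_endpoint 0 we) nl.
  rewrite odn; apply: le_trans; rewrite exprS.
  have r0 : 0 <= (1 - alpha R) ^+ n by rewrite exprn_ge0 // subr_ge0 ltW ?alpha_lt1.
  by have := ler_wpM2l r0 (occupancy_le s hx w e); lra.
have [_ nvu _] := edge_other ue.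
have -> : Pr x s B = x e * attenuation x s e *
    (Pr x s (free_approx s n u e) * Pr x s (free_approx s n v e)).
  rewrite -(Pr_indep_disjoint x s du dv dis) -(Pr_bits x s e true true).
  have d1 := depends_onS (subsetUl _ (edges_in (branch (neighborhood l e) u v))) du.
  have d2 := depends_onS (subsetUr (edges_in (branch (neighborhood l e) v u)) _) dv.
  apply: Pr_indep_disjoint (depends_on_active e) (depends_onI d1 d2) _.
  (* Each branch omits the opposite endpoint of [e], so neither contains [e]. *)
  rewrite disjoints1 in_setU negb_or; apply/andP; split; apply: branch_notin => //.
  - exact: inS.
  - by rewrite eq_sym.
  exact: inS.
have v1 := vacancy_gt0 s hx u e; have v2 := vacancy_gt0 s hx v e.
have r1 : 0 <= 1 - (1 - alpha R) ^+ n.+1.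
  by rewrite subr_ge0 exprn_ile1 // ?subr_ge0 ?lerBlDr ?lerDl ltW ?alpha_lt1 ?alpha_gt0.
(* The two vacancies cancel the denominator of the attenuation, leaving [alpha] times the squared
   error factor. *)
have -> : alpha_ R l * x e = x e * attenuation x s e *
    ((1 - (1 - alpha R) ^+ n.+1) * (1 - alpha R * x_before x s u e) *
     ((1 - (1 - alpha R) ^+ n.+1) * (1 - alpha R * x_before x s v e))).
  rewrite /alpha_ alpha_ratio -nS (attenuationE x s ue) -/v.
  by field; rewrite !lt0r_neq0.
apply: ler_wpM2l.
  by rewrite mulr_ge0 ?attenuation_ge0 // ltW.
by apply: ler_pM; rewrite ?low // mulr_ge0 // ltW.
Qed.
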